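(* Let $V$ be a smooth scheme over a field, let $\mathcal{G}=\bigoplus_n I_nW^n$ be a Rees algebra over $V$, let $x\in\mathrm{Sing}(\mathcal{G})$, and suppose that $\mathcal{G}$ is defined locally at $x$ by the set of generators $\{f_1W^{n_1},\dots,f_sW^{n_s}\}$ with all $n_i\ge1$, i.e. $\mathcal{G}=\mathcal{O}_{V,x}[f_1W^{n_1},\dots,f_sW^{n_s}]$ at $x$. Then $$\mathbb{I}_{\mathcal{G},x}=\langle \mathrm{In}_{n_1}(f_1),\dots,\mathrm{In}_{n_s}(f_s)\rangle .$$
   Context: A Rees algebra over a smooth scheme $V$ is a graded subalgebra $\mathcal{G}=\bigoplus_{n\ge 0} I_nW^n$ of $\mathcal{O}_V[W]$ ($W$ a dummy variable), where the $I_n$ are sheaves of ideals with $I_0=\mathcal{O}_V$ and $I_sI_t\subset I_{s+t}$, which is locally a finitely generated $\mathcal{O}_V$-algebra. The singular locus is $\mathrm{Sing}(\mathcal{G})=\{x\in V : \nu_x(I_n)\ge n \text{ for all } n\ge 1\}$, with $\nu_x(I_n)$ the order of $I_n$ at $\mathcal{O}_{V,x}$. For $f\in\mathfrak{M}_x^n$, where $\mathfrak{M}_x$ is the maximal ideal of $\mathcal{O}_{V,x}$, $\mathrm{In}_n(f)$ denotes the class of $f$ in $\mathfrak{M}_x^n/\mathfrak{M}_x^{n+1}$ (possibly zero). $\mathbb{I}_{\mathcal{G},x}$ is the homogeneous ideal of $gr_{\mathfrak{M}_x}(\mathcal{O}_{V,x})$ generated by the classes $\mathrm{In}_n(f)$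 of all $f\in I_n$ (at $x$), for all $n\ge1$. *)

(* Defs.v *)
From HB Require Import structures.
From mathcomp Require Import all_boot all_algebra.
From mathcomp Require Import boolp classical_sets topology.
(* The notations of mpoly clash with those of topology. *)
From mathcomp Require mpoly.
Import (canonicals) mpoly.

Set Implicit Arguments.
Unset Strict Implicit.
Unset Printing Implicit Defensive.

Import GRing.Theory.
Local Open Scope classical_set_scope.
Local Open Scope ring_scope.
Local Open Scope quotient_scope.

Section Ideals.
Variable R : comPzRingType.
Implicit Types (I J S : set R) (a b : R).

Definition is_ideal I :=
  [/\ I 0, forall a b, I a -> I b -> I (a + b) & forall a b, I b -> I (a * b)].

Definition ideal_gen S : set R :=
  [set a | forall J, is_ideal J -> S `<=` J -> J a].

Lemma ideal_gen_ideal S : is_ideal (ideal_gen S).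
Proof.
split=> [J [] //|a b Ia Ib J iJ SJ|a b Ib J iJ SJ]; have [_ JD JM] := iJ.
  exact: JD (Ia J iJ SJ) (Ib J iJ SJ).
exact: JM (Ib J iJ SJ).
Qed.

Lemma sub_ideal_gen S : S `<=` ideal_gen S.
Proof. by move=> a Sa J _; exact. Qed.

Lemma is_idealN I a : is_ideal I -> I a -> I (- a).
Proof. by case=> _ _ IM Ia; rewrite -mulN1r; apply: IM. Qed.

Definition ideal_mul I J : set R :=
  ideal_gen [set c | exists a b, [/\ I a, J b & c = a * b]].

Fixpoint ideal_pow I (n : nat) : set R :=
  if n is n'.+1 then ideal_mul I (ideal_pow I n') else setT.

Definition is_prime I :=
  [/\ is_ideal I, ~ I 1 & forall a b, I (a * b) -> I a \/ I b].

Definition invertible a := exists b, a * b = 1.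

Definition nonunits : set R := [set a | ~ invertible a].

Definition local_ring :=
  (1 : R) <> 0 /\ forall a b, nonunits a -> nonunits b -> nonunits (a + b).

End Ideals.

Definition localization_away (A B : comPzRingType) (f : A) (g : A -> B) :=
  [/\ invertible (g f),
      forall b, exists a m, g (f ^+ m) * b = g a
    & forall a, g a = 0 -> exists m, f ^+ m * a = 0].

HB.mixin Record isLocalRing R of GRing.ComNzRing R := {
  local_ringP : local_ring R
}.

#[short(type="localRingType")]
HB.structure Definition LocalRing := {R of isLocalRing R & GRing.ComNzRing R}.

Section LocalRing.
Variable R : localRingType.
Implicit Types (I : set R).

Definition maxideal : set R := @nonunits R.

Lemma maxideal_ideal : is_ideal maxideal.
Proof.
have [R10 RD] := local_ringP (s := R); split=> //.
  by case=> b; rewrite mul0r => /esym.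
by move=> a b nb [c abc]; apply: nb; exists (a * c); rewrite mulrCA mulrA.
Qed.

Definition mpow (n : nat) : set R := ideal_pow maxideal n.

Lemma mpow_ideal n : is_ideal (mpow n).
Proof. by case: n => [|n]; [split|exact: ideal_gen_ideal]. Qed.

Lemma mpowM i j a b : mpow i a -> mpow j b -> mpow (i + j) (a * b).
Proof.
elim: i a => [|i IHi] a /= ia jb.
  by have [_ _ jM] := mpow_ideal j; apply: jM.
apply: (ia [set c | mpow (i.+1 + j) (c * b)]) => //.
- have [m0 mD mM] := mpow_ideal (i.+1 + j); split=> [|c d|c d] /=.
  + by rewrite mul0r.
  + by rewrite mulrDl; apply: mD.
  + by rewrite -mulrA; apply: mM.
- move=> _ [c [d [mc id ->]]] /=; apply: sub_ideal_gen.
  by exists c, (d * b); split=> //; [apply: IHi|rewrite mulrA].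
Qed.

Lemma mpowS n : mpow n.+1 `<=` mpow n.
Proof.
move=> a; apply; first exact: mpow_ideal.
by move=> _ [b [c [_ nc ->]]]; have [_ _ nM] := mpow_ideal n; apply: nM.
Qed.

Lemma mpow1_1 : ~ mpow 1 1.
Proof.
move=> h; have: maxideal 1.
  apply: h; first exact: maxideal_ideal.
  move=> _ [b [c [mb _ ->]]]; rewrite mulrC.
  by have [_ _] := maxideal_ideal; apply.
by apply; exists 1; rewrite mulr1.
Qed.

Definition exact_order I (r : nat) := I `<=` mpow r /\ ~ (I `<=` mpow r.+1).

(* The order of an ideal, [None] standing for infinity: either [I] lies in every
   power of the maximal ideal, or there is exactly one [r] as below. *)
Definition ideal_order I : option nat :=
  if `[< exists r, exact_order I r >] then Some (xget 0%N (exact_order I))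
  else None.

Definition order_geq (nu : option nat) (n : nat) : bool :=
  if nu is Some r then (n <= r)%N else true.

(** The associated graded ring of [R] is realized as the quotient of the ring
    of polynomials [\sum_n a_n 'X^n] with [a_n \in m^n] by the ideal of those
    with [a_n \in m^(n+1)], that is [(\oplus_n m^n) / (\oplus_n m^(n+1))]. *)

Definition mrees_pred : {pred {poly R}} :=
  fun p => `[< forall n, mpow n p`_n >].

Fact mrees_subring : subring_closed mrees_pred.
Proof.
split=> [|p q /asboolP hp /asboolP hq|p q /asboolP hp /asboolP hq];
  apply/asboolP => n.
- by rewrite coef1; case: n => //= n; have [] := mpow_ideal n.+1.
- have [_ mD _] := mpow_ideal n; rewrite coefB.
  by apply: mD => //; apply: is_idealN => //; apply: mpow_ideal.
- have [m0 mD _] := mpow_ideal n; rewrite coefM.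
  apply: (big_ind (mpow n) m0 mD) => i _.
  have le_in : (i <= n)%N by rewrite -ltnS.
  by have := mpowM (hp i) (hq (n - i)%N); rewrite subnKC.
Qed.

HB.instance Definition _ :=
  GRing.isSubringClosed.Build {poly R} mrees_pred mrees_subring.

Record mrees := MRees { mrees_val :> {poly R}; _ : mrees_val \in mrees_pred }.
HB.instance Definition _ := [isSub for mrees_val].
HB.instance Definition _ := [Choice of mrees by <:].
HB.instance Definition _ := [SubChoice_isSubComNzRing of mrees by <:].

Definition mrees_ideal : {pred mrees} :=
  fun p => `[< forall n, mpow n.+1 (val p)`_n >].

Fact mrees_ideal_closed : idealr_closed mrees_ideal.
Proof.
split=> [||a p q /asboolP hp /asboolP hq].
- by apply/asboolP => n; rewrite coef0; have [] := mpow_ideal n.+1.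
- by apply/negP => /asboolP /(_ 0%N); rewrite coef1 => /mpow1_1.
- apply/asboolP => n; have [m0 mD _] := mpow_ideal n.+1.
  rewrite coefD; apply: (mD) => //; rewrite coefM.
  apply: (big_ind (mpow n.+1) m0 mD) => i _.
  have le_in : (i <= n)%N by rewrite -ltnS.
  have /asboolP ha := valP a.
  by have := mpowM (ha i) (hp (n - i)%N); rewrite addnS subnKC.
Qed.

HB.instance Definition _ := isIdealr.Build mrees mrees_ideal mrees_ideal_closed.

Definition gr := {ideal_quot mrees_ideal}.
HB.instance Definition _ := GRing.ComNzRing.on gr.

(* The class of [f] in [m^n / m^(n+1)]; junk value 0 when [f] is not in [m^n]. *)
Definition In (n : nat) (f : R) : gr :=
  \pi_gr (insubd (0 : mrees) (f *: 'X^n)).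

Lemma In_eq0 n f : mpow n f -> In n f = 0 <-> mpow n.+1 f.
Proof.
move=> nf.
have fP : f *: 'X^n \in mrees_pred.
  apply/asboolP => i; rewrite coefZ coefXn.
  have [->|_] := eqVneq i n; first by rewrite mulr1.
  by rewrite mulr0; have [] := mpow_ideal i.
have InE : In n f = 0 <-> insubd (0 : mrees) (f *: 'X^n) \in mrees_ideal.
  have e0 : (0 : gr) = \pi_gr 0 by rewrite -[RHS]/(\pi_{ideal_quot mrees_ideal} 0) pi_zeror.
  rewrite /In e0; split=> [/eqP|h].
    by rewrite -Quotient.idealrBE subr0.
  by apply/eqP; rewrite -Quotient.idealrBE subr0.
rewrite InE; split=> [/asboolP/(_ n)|Sf].
  by rewrite insubdK// coefZ coefXn eqxx mulr1.
apply/asboolP => i; rewrite insubdK// coefZ coefXn.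
have [->|_] := eqVneq i n; first by rewrite mulr1.
by rewrite mulr0; have [] := mpow_ideal i.+1.
Qed.

End LocalRing.

Definition is_subalg (R : comNzRingType) (B : set {poly R}) :=
  [/\ forall c : R, B c%:P, forall p q, B p -> B q -> B (p + q)
    & forall p q, B p -> B q -> B (p * q)].

Definition subalg_gen (R : comNzRingType) (S : set {poly R}) : set {poly R} :=
  [set p | forall B, is_subalg B -> S `<=` B -> B p].

Record opens (X : topologicalType) := Opens {
  pts :> set X;
  opensP : open pts
}.

Definition opensT (X : topologicalType) : opens X := Opens openT.
Definition opensI (X : topologicalType) (U W : opens X) : opens X :=
  Opens (openI (opensP U) (opensP W)).

Record presheaf (X : topologicalType) := Presheaf {
  sections :> opens X -> comPzRingType;
  res : forall U W : opens X, W `<=` U -> {rmorphism sections U -> sections W};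
  res_id : forall (U : opens X) (h : U `<=` U) s, res h s = s;
  res_comp : forall (U W Z : opens X) (hWU : W `<=` U) (hZW : Z `<=` W)
    (hZU : Z `<=` U) s, res hZW (res hWU s) = res hZU s
}.
Arguments res {X} F {U W} h : rename.

Definition is_sheaf (X : topologicalType) (F : presheaf X) :=
  forall (U : opens X) (I : Type) (Ui : I -> opens X)
    (sub : forall i, Ui i `<=` U), U `<=` \bigcup_i Ui i ->
  forall s : (forall i, F (Ui i)),
    (forall i j,
      res F (@subIsetl _ (Ui i) (Ui j) : opensI (Ui i) (Ui j) `<=` Ui i) (s i) =
      res F (@subIsetr _ (Ui i) (Ui j) : opensI (Ui i) (Ui j) `<=` Ui j) (s j)) ->
  exists! t : F U, forall i, res F (sub i) t = s i.

Section Stalk.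
Variables (X : topologicalType) (F : presheaf X) (x : X).

Record pregerm := Pregerm {
  pregerm_dom : opens X;
  pregerm_in : pts pregerm_dom x;
  pregerm_sec : F pregerm_dom
}.
HB.instance Definition _ := gen_eqMixin pregerm.
HB.instance Definition _ := gen_choiceMixin pregerm.

Definition germ_rel : rel pregerm := fun a b =>
  `[< exists (W : opens X) (ha : W `<=` pregerm_dom a)
        (hb : W `<=` pregerm_dom b),
      pts W x /\ res F ha (pregerm_sec a) = res F hb (pregerm_sec b) >].

Fact germ_rel_refl : reflexive germ_rel.
Proof.
move=> a; apply/asboolP; exists (pregerm_dom a), (@subset_refl _ _), (@subset_refl _ _).
by split=> //; apply: pregerm_in.
Qed.

Fact germ_rel_sym : symmetric germ_rel.
Proof.
by move=> a b; apply/asboolP/asboolP => -[W [h1 [h2 [Wx e]]]];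
  exists W, h2, h1; split.
Qed.

Fact germ_rel_trans : transitive germ_rel.
Proof.
move=> b a c /asboolP[W [h1 [h2 [Wx e]]]] /asboolP[Z [h3 [h4 [Zx e']]]].
apply/asboolP.
have sW : opensI W Z `<=` W by apply: subIsetl.
have sZ : opensI W Z `<=` Z by apply: subIsetr.
exists (opensI W Z), (subset_trans sW h1), (subset_trans sZ h4); split=> //.
rewrite -(res_comp h1 sW) -(res_comp h4 sZ) e -e'.
by rewrite (res_comp h2 sW (subset_trans sW h2)) (res_comp h3 sZ (subset_trans sW h2)).
Qed.

Canonical germ_equiv :=
  EquivRel germ_rel germ_rel_refl germ_rel_sym germ_rel_trans.

Definition pstalk := {eq_quot germ_rel}.
HB.instance Definition _ := Choice.on pstalk.
HB.instance Definition _ : EqQuotient pregerm germ_rel pstalk :=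
  EqQuotient.on pstalk.

Definition pgerm (U : opens X) (Ux : pts U x) (s : F U) : pstalk :=
  \pi_pstalk (Pregerm Ux s).

Lemma pgermP (U W : opens X) (Ux : pts U x) (Wx : pts W x) (s : F U) (t : F W) :
  pgerm Ux s = pgerm Wx t <->
  exists (Z : opens X) (hU : Z `<=` U) (hW : Z `<=` W),
    pts Z x /\ res F hU s = res F hW t.
Proof.
split; first by move=> /eqmodP/asboolP.
by move=> h; apply/eqmodP/asboolP.
Qed.

Lemma pgerm_res (U W : opens X) (Ux : pts U x) (Wx : pts W x) (h : W `<=` U) (s : F U) :
  pgerm Wx (res F h s) = pgerm Ux s.
Proof.
apply/pgermP; exists W, (@subset_refl _ _), h; split=> //.
by rewrite (res_comp h _ h).
Qed.

Lemma pgermW (a : pstalk) : exists (U : opens X) (Ux : pts U x) (s : F U),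
  a = pgerm Ux s.
Proof.
exists (pregerm_dom (repr a)), (pregerm_in (repr a)), (pregerm_sec (repr a)).
by rewrite -[LHS]reprK /pgerm; case: (repr a).
Qed.

Lemma pgermW2 (a b : pstalk) : exists (U : opens X) (Ux : pts U x) (s t : F U),
  a = pgerm Ux s /\ b = pgerm Ux t.
Proof.
have [U [Ux [s ->]]] := pgermW a; have [W [Wx [t ->]]] := pgermW b.
have hU : opensI U W `<=` U by apply: subIsetl.
have hW : opensI U W `<=` W by apply: subIsetr.
have UWx : pts (opensI U W) x by split.
exists (opensI U W), UWx, (res F hU s), (res F hW t).
by rewrite !pgerm_res.
Qed.

Lemma pgermW3 (a b c : pstalk) :
  exists (U : opens X) (Ux : pts U x) (s t r : F U),
    [/\ a = pgerm Ux s, b = pgerm Ux t & c = pgerm Ux r].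
Proof.
have [U [Ux [s [t [-> ->]]]]] := pgermW2 a b; have [W [Wx [r ->]]] := pgermW c.
have hU : opensI U W `<=` U by apply: subIsetl.
have hW : opensI U W `<=` W by apply: subIsetr.
have UWx : pts (opensI U W) x by split.
exists (opensI U W), UWx, (res F hU s), (res F hU t), (res F hW r).
by rewrite !pgerm_res.
Qed.

Section Op2.
Variable op : forall U : opens X, F U -> F U -> F U.
Hypothesis opE : forall (U W : opens X) (h : W `<=` U) s t,
  res F h (op s t) = op (res F h s) (res F h t).

Definition pstalk_op2 (a b : pstalk) : pstalk :=
  let U := pregerm_dom (repr a) in let W := pregerm_dom (repr b) in
  pgerm (conj (pregerm_in (repr a)) (pregerm_in (repr b)) : pts (opensI U W) x)
    (op (res F (@subIsetl _ U W : opensI U W `<=` U) (pregerm_sec (repr a)))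
        (res F (@subIsetr _ U W : opensI U W `<=` W) (pregerm_sec (repr b)))).

Lemma pstalk_op2E (U : opens X) (Ux : pts U x) (s t : F U) :
  pstalk_op2 (pgerm Ux s) (pgerm Ux t) = pgerm Ux (op s t).
Proof.
rewrite /pstalk_op2.
have := reprK (pgerm Ux s); have := reprK (pgerm Ux t).
case: (repr (pgerm Ux s)) => A Ax u; case: (repr (pgerm Ux t)) => B Bx v /=.
move=> /pgermP[Z [hZB [hZU [Zx eZ]]]] /pgermP[Y [hYA [hYU [Yx eY]]]].
have sY : opensI Y Z `<=` Y by apply: subIsetl.
have sZ : opensI Y Z `<=` Z by apply: subIsetr.
have sU := subset_trans sY hYU.
have sAB : opensI Y Z `<=` opensI A B.
  by move=> y [Yy Zy]; split; [exact: (hYA)|exact: (hZB)].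
apply/pgermP; exists (opensI Y Z), sAB, sU; split=> //.
rewrite !opE; congr (op _ _).
  rewrite (res_comp _ _ (subset_trans sY hYA)) -(res_comp hYA sY) eY.
  by rewrite (res_comp _ _ sU).
rewrite (res_comp _ _ (subset_trans sZ hZB)) -(res_comp hZB sZ) eZ.
by rewrite (res_comp _ _ sU).
Qed.
End Op2.

Definition pstalk_add := pstalk_op2 (fun U => @GRing.add (F U)).
Definition pstalk_mul := pstalk_op2 (fun U => @GRing.mul (F U)).
Definition pstalk_opp (a : pstalk) : pstalk :=
  pgerm (pregerm_in (repr a)) (- pregerm_sec (repr a)).
Definition pstalk0 : pstalk := @pgerm (opensT X) I 0.
Definition pstalk1 : pstalk := @pgerm (opensT X) I 1.

Let addE (U : opens X) (Ux : pts U x) (s t : F U) :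
  pstalk_add (pgerm Ux s) (pgerm Ux t) = pgerm Ux (s + t).
Proof. by apply: pstalk_op2E => *; rewrite rmorphD. Qed.

Let mulE (U : opens X) (Ux : pts U x) (s t : F U) :
  pstalk_mul (pgerm Ux s) (pgerm Ux t) = pgerm Ux (s * t).
Proof. by apply: pstalk_op2E => *; rewrite rmorphM. Qed.

Let oppE (U : opens X) (Ux : pts U x) (s : F U) :
  pstalk_opp (pgerm Ux s) = pgerm Ux (- s).
Proof.
rewrite /pstalk_opp; have := reprK (pgerm Ux s).
case: (repr (pgerm Ux s)) => A Ax u /= /pgermP[Z [hA [hU [Zx e]]]].
by apply/pgermP; exists Z, hA, hU; split=> //; rewrite !rmorphN e.
Qed.

Let zeroE (U : opens X) (Ux : pts U x) : pstalk0 = pgerm Ux 0.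
Proof.
have h : U `<=` opensT X by [].
by rewrite /pstalk0 -(pgerm_res _ Ux h) rmorph0.
Qed.

Let oneE (U : opens X) (Ux : pts U x) : pstalk1 = pgerm Ux 1.
Proof.
have h : U `<=` opensT X by [].
by rewrite /pstalk1 -(pgerm_res _ Ux h) rmorph1.
Qed.

Fact pstalk_addA : associative pstalk_add.
Proof.
move=> a b c; have [U [Ux [s [t [r [-> -> ->]]]]]] := pgermW3 a b c.
by rewrite !addE addrA.
Qed.
Fact pstalk_addC : commutative pstalk_add.
Proof.
move=> a b; have [U [Ux [s [t [-> ->]]]]] := pgermW2 a b.
by rewrite !addE addrC.
Qed.
Fact pstalk_add0 : left_id pstalk0 pstalk_add.
Proof.
by move=> a; have [U [Ux [s ->]]] := pgermW a; rewrite (zeroE Ux) addE add0r.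
Qed.
Fact pstalk_addN : left_inverse pstalk0 pstalk_opp pstalk_add.
Proof.
move=> a; have [U [Ux [s ->]]] := pgermW a.
by rewrite (zeroE Ux) oppE addE addNr.
Qed.
Fact pstalk_mulA : associative pstalk_mul.
Proof.
move=> a b c; have [U [Ux [s [t [r [-> -> ->]]]]]] := pgermW3 a b c.
by rewrite !mulE mulrA.
Qed.
Fact pstalk_mulC : commutative pstalk_mul.
Proof.
move=> a b; have [U [Ux [s [t [-> ->]]]]] := pgermW2 a b.
by rewrite !mulE mulrC.
Qed.
Fact pstalk_mul1 : left_id pstalk1 pstalk_mul.
Proof.
by move=> a; have [U [Ux [s ->]]] := pgermW a; rewrite (oneE Ux) mulE mul1r.
Qed.
Fact pstalk_mulD : left_distributive pstalk_mul pstalk_add.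
Proof.
move=> a b c; have [U [Ux [s [t [r [-> -> ->]]]]]] := pgermW3 a b c.
by rewrite !(addE, mulE) mulrDl.
Qed.

HB.instance Definition _ := GRing.isZmodule.Build pstalk
  pstalk_addA pstalk_addC pstalk_add0 pstalk_addN.
HB.instance Definition _ := GRing.Zmodule_isComPzRing.Build pstalk
  pstalk_mulA pstalk_mulC pstalk_mul1 pstalk_mulD.

Lemma pgermD (U : opens X) (Ux : pts U x) : {morph pgerm Ux : s t / s + t}.
Proof. by move=> s t; rewrite -addE. Qed.

Lemma pgermM (U : opens X) (Ux : pts U x) : {morph pgerm Ux : s t / s * t}.
Proof. by move=> s t; rewrite -mulE. Qed.

Lemma pgerm1 (U : opens X) (Ux : pts U x) : pgerm Ux 1 = 1.
Proof. by rewrite -(oneE Ux). Qed.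

End Stalk.

Record lrspace := LRSpace {
  lrs_space :> topologicalType;
  struct_sheaf : presheaf lrs_space;
  struct_sheafP : is_sheaf struct_sheaf;
  struct_stalkP : forall x, local_ring (pstalk struct_sheaf x)
}.
Notation "''O'" := (struct_sheaf _) (only parsing).

Definition stalk (V : lrspace) (x : V) : Type := pstalk (struct_sheaf V) x.
HB.instance Definition _ (V : lrspace) (x : V) :=
  GRing.ComPzRing.on (@stalk V x).

Fact stalk_1neq0 (V : lrspace) (x : V) : (1 : stalk x) != 0.
Proof. by apply/eqP; have [] := struct_stalkP x. Qed.

HB.instance Definition _ (V : lrspace) (x : V) :=
  GRing.PzSemiRing_isNonZero.Build (stalk x) (stalk_1neq0 x).
HB.instance Definition _ (V : lrspace) (x : V) :=
  isLocalRing.Build (stalk x) (struct_stalkP x).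

Definition germ (V : lrspace) (x : V) (U : opens V) (Ux : pts U x)
  (s : struct_sheaf V U) : stalk x := pgerm Ux s.

Section Spec.
Variable A : comPzRingType.

Record Spec := MkSpec { spec_set :> set A; specP : is_prime spec_set }.
HB.instance Definition _ := gen_eqMixin Spec.
HB.instance Definition _ := gen_choiceMixin Spec.

Definition basic_open (f : A) : set Spec := [set P | ~ spec_set P f].

Definition zariski_open (W : set Spec) :=
  exists E : set A, W = \bigcup_(f in E) basic_open f.

Fact zariski_openT : zariski_open setT.
Proof.
exists [set 1]; rewrite bigcup_set1; apply/seteqP; split=> // P _.
by have [] := specP P.
Qed.

Fact zariski_openI : setI_closed zariski_open.
Proof.
move=> _ _ [E ->] [E' ->].
exists [set f | exists a b, [/\ E a, E' b & f = a * b]].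
apply/seteqP; split=> P.
  move=> [[a Ea Pa] [b Eb Pb]]; exists (a * b); first by exists a, b.
  by have [_ _ Pp] := specP P; move=> /Pp[].
move=> [_ [a [b [Ea Eb ->]]] Pab]; have [[_ _ PM] _ _] := specP P.
split; [exists a => // Pa|exists b => // Pb]; apply: Pab; last exact: PM.
by rewrite mulrC; apply: PM.
Qed.

Fact zariski_open_bigU (I : Type) (W : I -> set Spec) :
  (forall i, zariski_open (W i)) -> zariski_open (\bigcup_i W i).
Proof.
move=> /choice[E WE]; exists (\bigcup_i E i).
apply/seteqP; split=> P.
  by move=> [i _]; rewrite WE => -[f Ef Pf]; exists f => //; exists i.
by move=> [f [i _ Ef] Pf]; exists i => //; rewrite WE; exists f.
Qed.

HB.instance Definition _ := isOpenTopological.Build Spec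
  zariski_openT zariski_openI zariski_open_bigU.

End Spec.

(* An isomorphism of ringed spaces from Spec A to the open subspace U of V:
   a homeomorphism, together with an isomorphism of the structure sheaves. The
   structure sheaf of Spec A is the one with sections A_f on the basic open
   D(f), so the latter amounts to a ring morphism A -> O(U) which makes O(D(f))
   the localization A_f for every f. *)
Record affine_chart (V : lrspace) (A : comPzRingType) (U : opens V) := {
  chart_map : Spec A -> V;
  chart_inj : injective chart_map;
  chart_range : range chart_map = U;
  chart_continuous : continuous chart_map;
  chart_open : forall W : set (Spec A), open W -> open (chart_map @` W);
  chart_ring : {rmorphism A -> struct_sheaf V U};
  chart_loc : forall (f : A) (W : opens V) (h : W `<=` U),
    (W : set V) = chart_map @` basic_open f ->
    localization_away f (res (struct_sheaf V) h \o chart_ring)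
}.

Record scheme := Scheme {
  scheme_space :> lrspace;
  scheme_affine : forall y : scheme_space,
    exists (A : comPzRingType) (U : opens scheme_space),
      pts U y /\ inhabited (affine_chart A U)
}.

(* A morphism V -> Spec k is the same as a ring morphism k -> O(V). *)
Record scheme_over (k : fieldType) := SchemeOver {
  over_scheme :> scheme;
  over_struct : {rmorphism k -> struct_sheaf over_scheme (opensT over_scheme)}
}.

(* A is isomorphic over k to k[X_1, .., X_(c+d)] / (g_1, .., g_c), where the
   Jacobian minor det (dg_j/dX_i)_(i, j <= c) is invertible in A. *)
Definition standard_smooth (k : fieldType) (A : comPzRingType)
    (kA : {rmorphism k -> A}) :=
  exists (c d : nat) (g : 'I_c -> mpoly.mpoly (c + d) k)
    (q : {rmorphism mpoly.mpoly (c + d) k -> A}),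
  [/\ forall a : k, q (mpoly.mpolyC (c + d) a) = kA a,
      forall b : A, exists p, q p = b,
      [set p | q p = 0] = ideal_gen (range g)
    & invertible (q (\det (\matrix_(i < c, j < c)
                             mpoly.mderiv (lshift d i) (g j))))].

Definition smooth (k : fieldType) (V : scheme_over k) :=
  forall y : V, exists (A : comPzRingType) (kA : {rmorphism k -> A})
    (U : opens V) (phi : affine_chart A U),
  [/\ pts U y,
      forall a : k, chart_ring phi (kA a) =
        res (struct_sheaf V) (@subsetT _ U : U `<=` opensT V) (over_struct V a)
    & standard_smooth kA].

Record ideal_sheaf (V : lrspace) := IdealSheaf {
  ideal_sections :> forall U : opens V, set (struct_sheaf V U);
  ideal_sectionsP : forall U, is_ideal (@ideal_sections U);
  ideal_res : forall (U W : opens V) (h : W `<=` U) s,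
    @ideal_sections U s -> @ideal_sections W (res (struct_sheaf V) h s);
  ideal_glue : forall (U : opens V) s,
    (forall y, pts U y -> exists (W : opens V) (h : W `<=` U),
       pts W y /\ @ideal_sections W (res (struct_sheaf V) h s)) ->
    @ideal_sections U s
}.
Arguments ideal_sections {V} _ U _ : rename.

Definition ideal_stalk (V : lrspace) (J : ideal_sheaf V) (x : V) :
    set (stalk x) :=
  [set a | exists (U : opens V) (Ux : pts U x) (s : struct_sheaf V U),
     J U s /\ a = germ Ux s].
Arguments ideal_stalk {V} J x _.

(* The stalk of [\oplus_n I_n W^n], as a subset of O_x[W]. *)
Definition graded_stalk (V : lrspace) (I : nat -> ideal_sheaf V) (x : V) :
    set {poly stalk x} :=
  [set p | forall n, ideal_stalk (I n) x p`_n].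
Arguments graded_stalk {V} I x _.

(* Finite generation near y: the morphism of sheaves of algebras
   O_U[T_1, .., T_r] -> \oplus_n I_n W^n given by sections f_i W^(m_i) over some
   neighbourhood U of y is surjective, that is, surjective on stalks. *)
Record rees_algebra (V : lrspace) := ReesAlgebra {
  rees_ideal :> nat -> ideal_sheaf V;
  rees_ideal0 : forall (U : opens V) s, rees_ideal 0%N U s;
  rees_idealM : forall i j (U : opens V) s t,
    rees_ideal i U s -> rees_ideal j U t -> rees_ideal (i + j)%N U (s * t);
  rees_fg : forall y : V, exists (U : opens V) (r : nat) (m : 'I_r -> nat)
      (f : 'I_r -> struct_sheaf V U),
    [/\ pts U y, forall i, rees_ideal (m i) U (f i)
      & forall (z : V) (Uz : pts U z), graded_stalk rees_ideal z =
          subalg_gen (range (fun i => germ Uz (f i) *: 'X^(m i)))]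
}.

Definition Sing (V : lrspace) (G : rees_algebra V) : set V :=
  [set x | forall n, (1 <= n)%N -> order_geq (ideal_order (ideal_stalk (G n) x)) n].

Definition initial_ideal (V : lrspace) (G : rees_algebra V) (x : V) :
    set (gr (stalk x)) :=
  ideal_gen [set a | exists (n : nat) (f : stalk x),
    [/\ (1 <= n)%N, ideal_stalk (G n) x f & a = In n f]].
Arguments initial_ideal {V} G x _.

(* Main.v *)
(** At a singular point every [I_n] lies in [m^n], so [In_n] is additive on [I_n]
    and multiplicative from [I_i] x [I_j] to [I_(i+j)]. Hence, for an ideal [J] of
    the graded ring, the polynomials [\sum_n a_n W^n] with [a_n] in [m^n], and
    [In_n(a_n)] in [J] for [n >= 1], form a subalgebra: in [a_i b_j] with
    [i + j >= 1] one of the two factors has positive degree. If [J] contains the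
    [In_(n_i)(f_i)], this subalgebra contains the generators [f_i W^(n_i)], hence
    the whole Rees algebra. *)
Require Import Defs.
From mathcomp Require Import all_boot all_algebra.
From mathcomp Require Import boolp classical_sets topology.

Local Open Scope classical_set_scope.
Local Open Scope ring_scope.
Local Open Scope quotient_scope.

Import GRing.Theory.

Section LocalRing.
Variable R : localRingType.
Implicit Types (a b : R) (I : set R) (J : set (gr R)).

Lemma mpow0 n : mpow n (0 : R).
Proof. by have [] := mpow_ideal R n. Qed.

Lemma mpowD n a b : mpow n a -> mpow n b -> mpow n (a + b).
Proof. by have [_ mD _] := mpow_ideal R n; apply: mD. Qed.

Lemma mpow_le m n : (m <= n)%N -> @mpow R n `<=` mpow m.
Proof.
move=> /subnKC <-; elim: (n - m)%N => [|d IHd]; first by rewrite addn0.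
by rewrite addnS; apply: subset_trans IHd; apply: mpowS.
Qed.

Lemma order_geq_sub I n : order_geq (ideal_order I) n -> I `<=` mpow n.
Proof.
rewrite /ideal_order; case: asboolP => [[r Ir] /= ler|noI _].
  (* An exact order exists here, so the default 0 of [xget] is not taken. *)
  have [Ix _] := xgetPex 0%N (ex_intro _ r Ir).
  exact: subset_trans Ix (mpow_le _ _ ler).
(* Infinite order: if [I] lies in [mpow n] but not in [mpow n.+1], then [n] is an exact order, which
   is excluded. *)
elim: n => [|n IHn]; first by move=> a _.
by apply: contrapT => nI; apply: noI; exists n.
Qed.

(** Membership in [mpow n] rules out the junk value in [In], so identities between initial forms
    reduce to identities between monomials. *)
Lemma insubd_monomial n a :
  mpow n a -> val (insubd (0 : mrees R) (a *: 'X^n)) = a *: 'X^n.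
Proof.
move=> na; have aP : a *: 'X^n \in @mrees_pred R; last exact: insubdK.
apply/asboolP => i; rewrite coefZ coefXn.
by have [->|_] := eqVneq i n; rewrite ?mulr1// mulr0; apply: mpow0.
Qed.

Lemma InD n a b : mpow n a -> mpow n b -> In n (a + b) = In n a + In n b.
Proof.
move=> na nb; rewrite /In -[RHS](rmorphD \pi_{ideal_quot (@mrees_ideal R)}).
congr (\pi _); apply: val_inj; rewrite [RHS]rmorphD /=.
by rewrite !insubd_monomial ?scalerDl//; apply: mpowD.
Qed.

Lemma InM i j a b :
  mpow i a -> mpow j b -> In (i + j) (a * b) = In i a * In j b.
Proof.
move=> ia jb; rewrite /In -[RHS](rmorphM \pi_{ideal_quot (@mrees_ideal R)}).
congr (\pi _); apply: val_inj; rewrite [RHS]rmorphM /=.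
rewrite !insubd_monomial//; last exact: mpowM.
by rewrite exprD -scalerAl -scalerAr scalerA.
Qed.

Lemma In0 n : In n (0 : R) = 0.
Proof. by apply/In_eq0; apply: mpow0. Qed.

(** Degree 0 is exempt from the condition on [J]: a subalgebra contains every constant [c], while
    [In 0 c] may lie outside [J]. *)
Definition initial_in J : set {poly R} :=
  [set p | forall m, mpow m p`_m /\ ((0 < m)%N -> J (In m p`_m))].

Lemma initial_in_subalg J : is_ideal J -> is_subalg (initial_in J).
Proof.
move=> [J0 JD JM]; split=> [c [|m]|p q Bp Bq m|p q Bp Bq m].
- by [].
- by rewrite coefC; split=> [|_]; [exact: mpow0|rewrite In0].
- have [mp Jp] := Bp m; have [mq Jq] := Bq m; rewrite coefD.
  by split=> [|m0]; [exact: mpowD|rewrite InD//; apply: JD; auto].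
rewrite coefM.
pose P a := mpow m a /\ ((0 < m)%N -> J (In m a)).
apply: (big_ind P) => [|a b [ma Ja] [mb Jb]|i _].
- by split=> [|_]; [exact: mpow0|rewrite In0].
- by split=> [|m0]; [exact: mpowD|rewrite InD//; apply: JD; auto].
have im : (i <= m)%N by rewrite -ltnS.
have [ip Jp] := Bp i; have [iq Jq] := Bq (m - i)%N; split=> [|m0].
  by have := mpowM ip iq; rewrite subnKC.
have := InM _ _ _ _ ip iq; rewrite subnKC// => ->.
have [i0|i_gt0] := posnP i; last by rewrite mulrC; apply/JM/Jp.
by apply/JM/Jq; rewrite i0 subn0.
Qed.

Lemma initial_in_monomial J n a :
  is_ideal J -> mpow n a -> J (In n a) -> initial_in J (a *: 'X^n).
Proof.
move=> [J0 _ _] na Ja m; rewrite coefZ coefXn.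
have [->|_] := eqVneq m n; first by rewrite mulr1.
by rewrite mulr0 In0; split=> //; apply: mpow0.
Qed.

End LocalRing.

Lemma graded_stalk_monomial (V : lrspace) (G : rees_algebra V) (x : V) n
    (a : stalk x) :
  graded_stalk G x (a *: 'X^n) <-> ideal_stalk (G n) x a.
Proof.
split=> [/(_ n)|Ga m]; first by rewrite coefZ coefXn eqxx mulr1.
rewrite coefZ coefXn; have [->|_] := eqVneq m n; first by rewrite mulr1.
rewrite mulr0; exists (opensT V), Logic.I, 0; split=> //.
by have [] := ideal_sectionsP (G m) (opensT V).
Qed.

Theorem lemma5p3 (k : fieldType) (V : scheme_over k) (smoothV : smooth V)
    (G : rees_algebra V) (x : V) (singx : Sing G x)
    (s : nat) (f : 'I_s -> stalk x) (n : 'I_s -> nat)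
    (n_ge1 : forall i, (1 <= n i)%N)
    (G_gen : graded_stalk G x = subalg_gen (range (fun i => f i *: 'X^(n i)))) :
  initial_ideal G x = ideal_gen (range (fun i => In (n i) (f i))).
Proof.
(* Used for both inclusions: it makes each [In (n i) (f i)] a generator of the initial ideal and, as
   [x] is singular, puts [f i] in [mpow (n i)]. *)
have Gf i : ideal_stalk (G (n i)) x (f i).
  by apply/graded_stalk_monomial; rewrite G_gen => B _; apply; exists i.
apply/seteqP; split=> a; apply; try exact: ideal_gen_ideal; last first.
  by move=> _ [i _ <-]; apply: sub_ideal_gen; exists (n i), (f i).
move=> _ [m [g [m_ge1 /graded_stalk_monomial Gg ->]]].
set J := ideal_gen _; have iJ : is_ideal J by apply: ideal_gen_ideal.
(* The coefficient of degree [m] is [g], and [m >= 1] makes the condition on [J] apply to it. *)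
suff /(_ m)[_ /(_ m_ge1)] : initial_in _ J (g *: 'X^m).
  by rewrite coefZ coefXn eqxx mulr1.
move: Gg; rewrite G_gen; apply; first exact: initial_in_subalg.
move=> _ [i _ <-]; apply: initial_in_monomial => //.
  exact: order_geq_sub (singx _ (n_ge1 i)) _ (Gf i).
by apply: sub_ideal_gen; exists i.
Qed.
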